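(* Let $Y$ be a Peano space, let $d$ be a metric on $Y$ generating its topology, and equip $C(I,Y)$ with the metric $\rho(f,g)=\sup_{t\in I} d(f(t),g(t))$. Let $\mathcal{P}_Y\subset C(I,Y)$ be the set of all continuous surjective mappings $I\to Y$. Then: (a) $\mathcal{P}_Y$ is closed in $C(I,Y)$. In particular, $\mathcal{P}_Y$ is a completely metrizable space. (b) If $Y$ has at least two points, then $\mathcal{P}_Y$ is not compact. (c) Assume that $Y$ has at least two points and that there is $y_0\in Y$ with the following property: for every neighborhood $U$ of $y_0$ there exists a neighborhood $V$ of $y_0$ such that $V\subset U$ and $V\setminus\{y_0\}$ is arcwise connected. Then $\mathcal{P}_Y$ has empty interior in $C(I,Y)$; hence $\mathcal{P}_Y$ is nowhere dense in $C(I,Y)$. (d) In the case $Y=I^2$, with $d$ the metric $d_\infty((a,b),(a',b'))=\max\{|a-a'|,|b-b'|\}$, the set $\mathcal{P}=\mathcal{P}_{I^2}$ is strongly porous in $C(I,I^2)$.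
   Context: $I=[0,1]$ and $I^2=[0,1]\times[0,1]$. A Peano space is a (nonempty) compact, connected, locally connected, metrizable topological space; equivalently (Hahn--Mazurkiewicz theorem), a Hausdorff space that is a continuous image of $I$. $C(I,Y)$ is the set of continuous mappings $I\to Y$. A subset $A$ of a metric space $(X,D)$ is called porous if there is $\alpha>0$ such that for each $x\in X$ and each $\varepsilon>0$ there exists $y\in B(x,\varepsilon)$, $y\neq x$, such that $B(y,\alpha D(x,y))\cap A=\varnothing$, where $B(x,r)$ denotes the open ball of center $x$ and radius $r$. If the number $\alpha>0$ can be chosen as close to $1$ as we wish (i.e. the condition holds for every $\alpha\in(0,1)$), then $A$ is called strongly porous. *)

(* Defs.v *)
From HB Require Import structures.
From mathcomp Require Import all_boot all_order all_algebra.
From mathcomp Require Import all_classical all_reals all_analysis.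
From mathcomp Require Import lra.

Set Implicit Arguments.
Unset Strict Implicit.
Unset Printing Implicit Defensive.

Import Order.TTheory GRing.Theory Num.Theory.
Import numFieldTopology.Exports.

Local Open Scope classical_set_scope.
Local Open Scope ring_scope.

Section topological_notions.
Context (R : realType).

Record generating_metric (T : topologicalType) (m : T -> T -> R) : Prop := {
  gmetric_refl : forall x, m x x = 0 ;
  gmetric_pos : forall x y, m x y = 0 -> x = y ;
  gmetric_sym : forall x y, m x y = m y x ;
  gmetric_triangle : forall y x z, m x z <= m x y + m y z ;
  gmetric_nbhs : forall x : T,
    nbhs x = nbhs_ball_ (fun c e => [set y | m c y < e]) x }.

Definition metrizable (T : topologicalType) : Prop :=
  exists m : T -> T -> R, generating_metric m.

Definition complete_metric (T : topologicalType) (m : T -> T -> R) : Prop :=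
  forall u : nat -> T,
    (forall e : R, 0 < e -> exists N : nat, forall i j : nat,
       (N <= i)%N -> (N <= j)%N -> m (u i) (u j) < e) ->
    exists l : T, u @ \oo --> l.

Definition completely_metrizable (T : topologicalType) : Prop :=
  exists m : T -> T -> R, generating_metric m /\ complete_metric m.

Definition locally_connected (T : topologicalType) : Prop :=
  forall (x : T) (U : set T), nbhs x U ->
    exists V : set T, [/\ open V, V x, connected V & V `<=` U].

Definition peano_space (T : topologicalType) : Prop :=
  [/\ [set: T] !=set0, compact [set: T], connected [set: T],
      locally_connected T & metrizable T].

End topological_notions.

Definition nowhere_dense (T : topologicalType) (A : set T) : Prop :=
  interior (closure A) = set0.

(* [ball] is the open ball of [mdist] ([ballEmdist]). *)
Definition strongly_porous (R : realType) (X : metricType R) (A : set X) : Prop :=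
  forall alpha : R, 0 < alpha -> alpha < 1 ->
  forall (x : X) (e : R), 0 < e ->
  exists y : X, [/\ ball x e y, y <> x &
    ball y (alpha * mdist x y) `&` A = set0].

Section unit_interval.
Context (R : realType).

Definition unit_interval : Type := set_type `[0 : R, 1]%classic.

HB.instance Definition _ := Choice.on unit_interval.
HB.instance Definition _ := PseudoMetric.on unit_interval.

Let dist (s t : unit_interval) : R := `|val s - val t|.

Let dist_ge0 s t : 0 <= dist s t. Proof. exact: normr_ge0. Qed.

Let dist_positivity s t : dist s t = 0 -> s = t.
Proof.
by move=> /normr0_eq0/eqP; rewrite subr_eq0 => /eqP; exact: val_inj.
Qed.

Let ballEdist (s : unit_interval) (e : R) :
  ball s e = [set t | dist s t < e].
Proof. by []. Qed.

HB.instance Definition _ := @PseudoMetric_isMetric.Build R unit_interval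
  dist dist_ge0 dist_positivity ballEdist.

Lemma unit_interval_mdistE (s t : unit_interval) :
  mdist s t = `|val s - val t|.
Proof. by []. Qed.

Fact unit_interval0_subproof : (0 : R) \in `[0 : R, 1]%classic.
Proof. by rewrite inE /= in_itv /= lexx ler01. Qed.

Fact unit_interval1_subproof : (1 : R) \in `[0 : R, 1]%classic.
Proof. by rewrite inE /= in_itv /= lexx ler01. Qed.

Definition ui0 : unit_interval := exist _ (0 : R) unit_interval0_subproof.
Definition ui1 : unit_interval := exist _ (1 : R) unit_interval1_subproof.

End unit_interval.

(* The maximum metric on a product; it induces the product topology. *)
Section prod_metric.
Context (R : realType) (T U : metricType R).

Let dist (p q : T * U) : R := Num.max (mdist p.1 q.1) (mdist p.2 q.2).

Let dist_ge0 p q : 0 <= dist p q.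
Proof. by rewrite le_max mdist_ge0. Qed.

Let dist_positivity p q : dist p q = 0 -> p = q.
Proof.
case: p q => [a b] [c d] /= /eqP; rewrite eq_le ge_max => /andP[/andP[/= h1 h2] _].
by congr (_, _); apply: (@mdist_positivity R); apply/eqP;
  rewrite eq_le mdist_ge0 ?h1 ?h2.
Qed.

Let ballEdist (p : T * U) (e : R) : ball p e = [set q | dist p q < e].
Proof.
apply/seteqP; split => q; rewrite /ball/= /prod_ball/= !ballEmdist/= /dist gt_max.
  by move=> [-> ->].
by move=> /andP.
Qed.

HB.instance Definition _ := @PseudoMetric_isMetric.Build R (T * U)%type
  dist dist_ge0 dist_positivity ballEdist.

Lemma prod_mdistE (p q : T * U) :
  mdist p q = Num.max (mdist p.1 q.1) (mdist p.2 q.2).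
Proof. by []. Qed.

End prod_metric.

Definition embedding (T U : topologicalType) (g : T -> U) : Prop :=
  [/\ continuous g, injective g &
    forall A : set T, open A ->
      exists2 B : set U, open B & g @` A = range g `&` B].

Definition arcwise_connected (R : realType) (T : topologicalType) (A : set T) : Prop :=
  forall a b : T, A a -> A b -> a <> b ->
    exists g : unit_interval R -> T,
      [/\ embedding g, g (ui0 R) = a, g (ui1 R) = b & range g `<=` A].

(* An alias of [continuousType], so that its topology is the one of the
   supremum metric and not one of the library's function space topologies. *)
Section continuous_maps.
Context (R : realType) (Y : metricType R).

Definition cmaps : Type := continuousType (unit_interval R) Y.

HB.instance Definition _ := Choice.on cmaps.

Let dists (f g : cmaps) : set R :=
  [set mdist (f t) (g t) | t in [set: unit_interval R]].

Let dist (f g : cmaps) : R := sup (dists f g).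

Let dist_continuous (f g : cmaps) :
  continuous (fun t => mdist (f t) (g t) : R).
Proof.
move=> t; apply/(cvgrPdist_lt (FF := nbhs_filter t)) => e e0.
have e20 : 0 < e / 2 by rewrite divr_gt0.
have Hf := metricType_numDomainType.cvgr_dist_lt (FF := nbhs_filter t)
  (@cts_fun _ _ f t) e20.
have Hg := metricType_numDomainType.cvgr_dist_lt (FF := nbhs_filter t)
  (@cts_fun _ _ g t) e20.
near=> s.
have hf : mdist (f t) (f s) < e / 2 by near: s.
have hg : mdist (g t) (g s) < e / 2 by near: s.
have h1 := metric_triangle (f t) (f s) (g t).
have h2 := metric_triangle (f s) (g s) (g t).
have h3 := metric_triangle (f s) (f t) (g s).
have h4 := metric_triangle (f t) (g t) (g s).
rewrite (metric_sym (g s)) in h2; rewrite (metric_sym (f s) (f t)) in h3.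
by rewrite ltr_norml; apply/andP; split; lra.
Unshelve. all: by end_near. Qed.

Let dists_nonempty (f g : cmaps) : dists f g !=set0.
Proof. by exists (mdist (f (ui0 R)) (g (ui0 R))), (ui0 R). Qed.

Let dists_has_sup (f g : cmaps) : has_sup (dists f g).
Proof.
split; first exact: dists_nonempty.
pose h : unit_interval R -> R := fun t => mdist (f t) (g t).
have /subspace_valL_continuousP ch : continuous h by exact: dist_continuous.
have [c _ hc] := EVT_max ler01 ch.
exists (valL h c) => _ [t _ <-].
have := hc (val t); rewrite -[valL h (val t)]/((valL h \o val) t).
have tI : val t \in `[0, 1] by case: t => t /=; rewrite inE.
move=> /(_ tI); congr (_ <= _).
exact: (congr1 (fun k => k t) (@valLK _ _ point _ h)).
Qed.

Let dist_ub (f g : cmaps) t : mdist (f t) (g t) <= dist f g.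
Proof. by apply: ub_le_sup; [case: (dists_has_sup f g) | exists t]. Qed.

Let dist_le (f g : cmaps) (e : R) :
  (forall t, mdist (f t) (g t) <= e) -> dist f g <= e.
Proof.
by move=> h; apply: ge_sup; [exact: dists_nonempty | move=> _ [t _ <-]].
Qed.

Let distxx f : dist f f = 0.
Proof.
apply/eqP; rewrite eq_le; apply/andP; split.
  by apply: dist_le => t; rewrite mdistxx.
by have := dist_ub f f (ui0 R); rewrite mdistxx.
Qed.

Let dist_positivity f g : dist f g = 0 -> f = g.
Proof.
move=> fg0; apply/continuousEP => t; apply: (@mdist_positivity R).
by apply/eqP; rewrite eq_le mdist_ge0 -[X in _ <= X]fg0 dist_ub.
Qed.

Let dist_sym f g : dist f g = dist g f.
Proof.
congr sup; apply/seteqP; split => _ [t _ <-]; exists t => //;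
  exact: metric_sym.
Qed.

Let dist_triangle g f h : dist f h <= dist f g + dist g h.
Proof.
apply: dist_le => t; apply: le_trans (metric_triangle _ (g t) _) _.
by rewrite lerD.
Qed.

HB.instance Definition _ := @isMetric.Build R cmaps
  dist distxx dist_positivity dist_sym dist_triangle.

Lemma cmaps_mdistE (f g : cmaps) :
  mdist f g = sup [set mdist (f t) (g t) | t in [set: unit_interval R]].
Proof. by []. Qed.

Definition peano_maps : set cmaps :=
  [set f | set_surj [set: unit_interval R] [set: Y] f].

End continuous_maps.

Arguments peano_maps {R} Y.

(* Main.v *)
(* (a) The image of a uniform limit of surjections is compact and dense.

   (b) [peano_maps Y] is nonempty by the Hahn-Mazurkiewicz theorem, and if [f]
   belongs to it then so do the maps [f (min (1, n t))], whose only possible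
   cluster point is the constant map [f 1].
   For Hahn-Mazurkiewicz, cover [Y] by finite chains of connected sets whose
   consecutive members meet.  A connected member [U] of a chain can be replaced
   by a walk through the finitely many members of a fine open cover that meet
   [U], because these form a connected nerve; the walk visits all of them, so
   the refined chain still covers [Y].  Matching the n-th chain with a uniform
   subdivision of the unit interval gives step functions which converge
   uniformly to a continuous surjection.

   (c) Cut the interval so finely that on every piece [f] either omits [y0] or
   stays in the given neighbourhood [V]; on the pieces of the second kind,
   replace [f] by an arc in [V] minus [y0].

   (d) Raising the first coordinate of [f] to at least [r], by moving it by at
   most [r], yields a map that keeps the distance [r] from the corner [(0, 0)].
   If that coordinate is constantly 1, so that it cannot be raised, lower it to
   [1 - r] instead.
*)

From HB Require Import structures.
Require Import Defs.
From mathcomp Require Import all_boot all_order all_algebra.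
From mathcomp Require Import all_classical all_reals all_analysis.
From mathcomp Require Import ring lra.

Set Implicit Arguments.
Unset Strict Implicit.
Unset Printing Implicit Defensive.

Import Order.TTheory GRing.Theory Num.Theory.
Import numFieldTopology.Exports.

Local Open Scope classical_set_scope.
Local Open Scope ring_scope.

(** * Metric spaces and maps from the unit interval *)

Section metric_spaces.
Context (R : realType).
Implicit Types T U : metricType R.

Lemma metric_continuousP T U (f : T -> U) : continuous f <->
  forall x (e : R), 0 < e -> exists2 d : R, 0 < d &
    forall y, mdist x y < d -> mdist (f x) (f y) < e.
Proof.
split=> [cf x e e0|cf x].
  have := metricType_numDomainType.cvgr_dist_lt (FF := nbhs_filter x) (cf x) e0.
  by move=> /metricType_numDomainType.nbhs_mdistP[d /= d0 hd]; exists d.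
apply/(metricType_numDomainType.cvgrPdist_lt (FF := nbhs_filter x)) => e e0.
apply/metricType_numDomainType.nbhs_mdistP.
by have [d d0 hd] := cf x e e0; exists d.
Qed.

Lemma metric_cvgP T (u : nat -> T) (l : T) : u @ \oo --> l <->
  forall e : R, 0 < e -> exists N, forall n, (N <= n)%N -> mdist l (u n) < e.
Proof.
split=> [ul e e0|ul].
  have [N _ hN] := metricType_numDomainType.cvgr_dist_lt ul e0.
  by exists N.
apply/metricType_numDomainType.cvgrPdist_lt => e e0.
by have [N hN] := ul e e0; exists N.
Qed.

Lemma metric_closureP T (A : set T) x :
  closure A x <-> forall e : R, 0 < e -> exists2 y, A y & mdist x y < e.
Proof.
split=> [clA e e0|h B].
  have [|y [Ay xy]] := clA (ball x e); first exact: nbhsx_ballx.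
  by exists y => //; move: xy; rewrite ballEmdist.
move=> /metricType_numDomainType.nbhs_mdistP[e /= e0 he].
by have [y Ay xy] := h e e0; exists y; split => //; exact: he.
Qed.

Lemma compact_dense T (A : set T) : compact A ->
  (forall y (e : R), 0 < e -> exists2 z, A z & mdist y z < e) -> A = setT.
Proof.
move=> cA dA; apply/seteqP; split=> // y _.
have := compact_closed (@metric_hausdorff _ _) cA.
by move/closure_id => ->; apply/metric_closureP => e; exact: dA.
Qed.

(** Compactness enters in its near-covering form, along radii tending to 0 from the right: near each
    point every radius below half of the local modulus works, so some radius works at all points. *)
Lemma compact_uniformly_continuous T U (f : T -> U) :
  compact [set: T] -> continuous f -> forall e : R, 0 < e ->
  exists2 d : R, 0 < d & forall x y, mdist x y < d -> mdist (f x) (f y) < e.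
Proof.
move=> /compact_near_coveringP cT /metric_continuousP cf e e0.
pose P (d : R) (x : T) := 0 < d -> forall y, mdist x y < d ->
  mdist (f x) (f y) < e.
have := cT R (0^'+) P _.
case=> [x _|d /= d0 hd].
  have [|d d0 hd] := cf x (e / 2); first by lra.
  have d20 : 0 < d / 2 by lra.
  near=> z r => /= r0 y zy; have xz : mdist x z < d / 2.
    near: z; apply/metricType_numDomainType.nbhs_mdistP.
    by exists (d / 2).
  have rd : r < d / 2 by near: r; exact: nbhs_right_lt.
  have h1 : mdist (f x) (f z) < e / 2 by apply: hd; lra.
  have h2 : mdist (f x) (f y) < e / 2.
    apply: hd; apply: le_lt_trans (metric_triangle _ z _) _; lra.
  apply: le_lt_trans (metric_triangle _ (f x) _) _.
  by rewrite (metric_sym (f z)); lra.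
exists (d / 2); first by lra.
move=> x y xy; apply: (hd (d / 2)) => //; last by lra.
  by rewrite /= sub0r normrN gtr0_norm; lra.
by lra.
Unshelve. all: by end_near. Qed.

(** A cluster point of a Cauchy sequence is its limit. *)
Lemma compact_complete T : compact [set: T] -> complete_metric (@mdist R T).
Proof.
move=> cT u cu.
have [|p [_ clp]] := cT (u @ \oo) _ _; first exact: filterT.
exists p; apply/metric_cvgP => e e0.
have [|N hN] := cu (e / 2); first by lra.
exists N => n Nn.
have hu : (u @ \oo) (u @` [set m | (N <= m)%N]).
  by exists N => // m /= Nm; exists m.
have hp : nbhs p (ball p (e / 2)) by apply: nbhsx_ballx; lra.
have [_ [[m /= Nm <-]]] := clp _ _ hu hp.
rewrite ballEmdist /= => pm.
apply: le_lt_trans (metric_triangle _ (u m) _) _.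
by have := hN m n Nm Nn; lra.
Qed.

End metric_spaces.

(** * The unit interval as a Lipschitz retract of the line *)

Section unit_interval_facts.
Context (R : realType).
Local Notation I := (unit_interval R).

Lemma unit_interval_ge0 (t : I) : 0 <= val t.
Proof. by case: t => t /=; rewrite inE /= in_itv /= => /andP[]. Qed.

Lemma unit_interval_le1 (t : I) : val t <= 1.
Proof. by case: t => t /=; rewrite inE /= in_itv /= => /andP[]. Qed.

Fact clamp_subproof (x : R) : Num.max 0 (Num.min 1 x) \in `[0 : R, 1]%classic.
Proof.
by rewrite inE /= in_itv /= le_max lexx /= ge_max ler01 ge_min lexx.
Qed.

(** The nearest-point retraction of the line onto [I]. It allows maps on [I] to be composed with
    real formulas whose values may leave the interval. *)
Definition clamp (x : R) : I :=
  exist (fun z : R => z \in `[0 : R, 1]%classic) _ (clamp_subproof x).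

Lemma val_clamp x : 0 <= x -> x <= 1 -> val (clamp x) = x.
Proof. by move=> x0 x1 /=; rewrite min_r// max_r. Qed.

Lemma valK_clamp (t : I) : clamp (val t) = t.
Proof.
apply/val_inj; rewrite val_clamp//.
  exact: unit_interval_ge0.
exact: unit_interval_le1.
Qed.

Lemma clamp_lipschitz (x y : R) : mdist (clamp x) (clamp y) <= `|x - y|.
Proof.
rewrite unit_interval_mdistE /=.
have := ler_norm (x - y); have := ler_norm (y - x); rewrite (distrC y).
by case: (leP 1 x) => ?; case: (leP 1 y) => ?; case: (leP 0 x) => ?;
  case: (leP 0 y) => ?; case: (leP (0 : R) 1) => ? ? ?;
  rewrite ler_norml; apply/andP; split; lra.
Qed.

Lemma clamp_continuous : continuous (clamp : R^o -> I).
Proof.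
apply/(metric_continuousP (T := R^o)) => x e e0; exists e => // y xy.
by rewrite (le_lt_trans (clamp_lipschitz _ _))// distrC.
Qed.

Lemma val_continuous : continuous (val : I -> R^o).
Proof.
apply/(metric_continuousP (U := R^o)) => x e e0; exists e => // y.
by rewrite unit_interval_mdistE distrC.
Qed.

Lemma unit_interval_compact : compact [set: I].
Proof.
have -> : [set: I] = (clamp : R^o -> I) @` `[0, 1]%classic.
  apply/seteqP; split=> // t _; exists (val t); last exact: valK_clamp.
  by case: t => t /=; rewrite inE.
apply: continuous_compact (@segment_compact R 0 1).
exact/continuous_subspaceT/clamp_continuous.
Qed.

End unit_interval_facts.

(** * The supremum metric and its completeness *)

Section sup_metric.
Context (R : realType) (Y : metricType R).
Local Notation I := (unit_interval R).
Implicit Types f g : cmaps Y.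

Lemma cmap_of_continuous (h : I -> Y) : continuous h ->
  exists f : cmaps Y, forall t, f t = h t.
Proof. by move=> ch; exists (mkcts ch). Qed.

(* An unbounded set has supremum 0, which would force [f = g]. *)
Lemma cmaps_mdist_ub f g t : mdist (f t) (g t) <= mdist f g.
Proof.
have [hs|hs] := pselect (has_sup [set mdist (f t) (g t) | t in [set: I]]).
  by rewrite cmaps_mdistE; apply: ub_le_sup; [case: hs|exists t].
have fg : mdist f g = 0 by rewrite cmaps_mdistE sup_out.
by rewrite fg (mdist_positivity _ _ fg) mdistxx.
Qed.

Lemma cmaps_mdist_le f g e :
  (forall t, mdist (f t) (g t) <= e) -> mdist f g <= e.
Proof.
move=> h; rewrite cmaps_mdistE; apply: ge_sup.
  by exists (mdist (f (ui0 R)) (g (ui0 R))), (ui0 R).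
by move=> _ [t _ <-].
Qed.

Lemma cmaps_continuous f : continuous f.
Proof. exact: cts_fun. Qed.

Lemma cmaps_complete : complete_metric (@mdist R Y) ->
  complete_metric (@mdist R (cmaps Y)).
Proof.
move=> cY u cu.
have ct t : exists l : Y, (fun n => u n t : Y) @ \oo --> l.
  apply: cY => e e0; have [N hN] := cu e e0; exists N => i j Ni Nj.
  exact: le_lt_trans (cmaps_mdist_ub _ _ t) (hN i j Ni Nj).
have [l hl] := choice ct.
have unif e : 0 < e -> exists N, forall n, (N <= n)%N ->
    forall t, mdist (l t) (u n t) <= e.
  move=> e0; have [|N hN] := cu (e / 2); first by lra.
  exists N => n Nn t; have [|M hM] := (metric_cvgP _ _).1 (hl t) (e / 2).
    by lra.
  (* The index [M] depends on [t], but it serves only as an intermediate stage; the resulting bound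
     holds from [N] on, uniformly in [t]. *)
  have h1 := hM (maxn N M) (leq_maxr _ _).
  have h2 := hN (maxn N M) n (leq_maxl _ _) Nn.
  have h3 := cmaps_mdist_ub (u (maxn N M)) (u n) t.
  have := metric_triangle (l t) (u (maxn N M) t) (u n t); lra.
have cl : continuous l.
  apply/metric_continuousP => t e e0.
  have [|N hN] := unif (e / 4); first by lra.
  have [|d d0 hd] :=
    (metric_continuousP _).1 (@cmaps_continuous (u N)) t (e / 4).
    by lra.
  exists d => // s ts; have h1 := hN N (leqnn _) t; have h2 := hN N (leqnn _) s.
  have h3 := hd s ts; have h4 := metric_triangle (l t) (u N t) (l s).
  have h5 := metric_triangle (u N t) (u N s) (l s).
  by rewrite (metric_sym (u N s)) in h5; lra.
have [f fl] := cmap_of_continuous cl.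
exists f; apply/metric_cvgP => e e0; have [|N hN] := unif (e / 2); first by lra.
exists N => n Nn; have : mdist f (u n) <= e / 2.
  by apply: cmaps_mdist_le => t; rewrite fl; exact: hN.
lra.
Qed.

End sup_metric.

(** * The Hahn-Mazurkiewicz theorem *)

Section walks.
Context (T : topologicalType) (J : eqType) (F : J -> set T).
Implicit Types (D : set J) (U : set T) (x y z : T) (l s : seq J).

(* Consecutive members of the list share a point, the first one contains [x]
   and the last one contains [y]. *)
Fixpoint walk D x y l : Prop :=
  if l is j :: l' then [/\ D j, F j x & exists2 z, F j z & walk D z y l']
  else x = y.

Lemma walk_cat D x z y l1 l2 :
  walk D x z l1 -> walk D z y l2 -> walk D x y (l1 ++ l2).
Proof.
elim: l1 x => [x /= -> //|j l1 IH x /= [Dj Fjx [w Fjw hw]] h2].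
by split => //; exists w => //; exact: IH.
Qed.

Lemma walk_nseq D y j k : D j -> F j y -> walk D y y (nseq k j).
Proof. by move=> Dj Fjy; elim: k => //= k IH; split => //; exists y. Qed.

Lemma walk_mem D x y l j : walk D x y l -> j \in l -> D j.
Proof.
elim: l x => // i l IH x /= [Di _ [z _ hz]].
by rewrite in_cons => /orP[/eqP -> //|]; exact: IH hz.
Qed.

Lemma walk_head D x y l j0 : walk D x y l -> (0 < size l)%N ->
  F (nth j0 l 0) x.
Proof. by case: l => //= j l []. Qed.

Lemma walk_last D x y l j0 : walk D x y l -> (0 < size l)%N ->
  F (nth j0 l (size l).-1) y.
Proof.
elim: l x => // j [|j' l] IH x /= [_ _ [z Fjz hz]] _; first by rewrite -hz.
exact: IH hz _.
Qed.

Lemma walk_meet D x y l j0 i : walk D x y l -> (i.+1 < size l)%N ->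
  F (nth j0 l i) `&` F (nth j0 l i.+1) !=set0.
Proof.
elim: l x i => // j l IH x [|i] /= [_ _ [z Fjz hz]]; rewrite ltnS => hl.
  by exists z; split => //; exact: walk_head hz hl.
exact: IH hz hl.
Qed.

(* The points that a walk from [x] can reach form a clopen subset of [U]. *)
Lemma connected_walk D U : connected U -> (forall j, D j -> open (F j)) ->
  U `<=` cover D F -> forall x y, U x -> U y -> exists l, walk D x y l.
Proof.
move=> cU oF UF x y Ux Uy.
pose C := [set z | exists l, walk D x z l].
have CF j : D j -> F j `&` C !=set0 -> F j `<=` C.
  move=> Dj [z [Fz [l hl]]] w Fw; exists (l ++ [:: j]).
  by apply: walk_cat hl _; split => //; exists w.
suff UC : U `&` C = U by move: Uy; rewrite -UC => -[].
apply: cU; first by exists x; split => //; exists [::].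
- exists (\bigcup_(j in [set j | D j /\ F j `&` C !=set0]) F j).
    by apply: bigcup_open => j [Dj _]; exact: oF.
  apply/seteqP; split=> z [Uz hz]; split => //.
    by have [j Dj Fj] := UF z Uz; exists j => //; split => //; exists z.
  by have [j [Dj h] Fj] := hz; exact: CF h _ Fj.
- exists (~` \bigcup_(j in [set j | D j /\ ~ (F j `&` C !=set0)]) F j).
    by apply: open_closedC; apply: bigcup_open => j [Dj _]; exact: oF.
  apply/seteqP; split=> z [Uz hz]; split => //.
    by move=> [j [_ h] Fj]; apply: h; exists z.
  have [j Dj Fj] := UF z Uz.
  have [h|h] := pselect (F j `&` C !=set0); first exact: CF h _ Fj.
  by exfalso; apply: hz; exists j.
Qed.

(** Induction on [s]: walk to a point of [U] inside the first prescribed member, step through that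
    member, and continue from there with the rest of the list. *)
Lemma connected_tour D U : connected U -> (forall j, D j -> open (F j)) ->
  U `<=` cover D F -> (forall j, D j -> F j `&` U !=set0) ->
  forall s, (forall j, j \in s -> D j) ->
  forall x y, U x -> U y -> exists2 l, walk D x y l & {subset s <= l}.
Proof.
move=> cU oF UF meetU; elim=> [_ x y Ux Uy|j s IH sD x y Ux Uy].
  by have [l hl] := connected_walk cU oF UF Ux Uy; exists l.
have Dj : D j by apply: sD; rewrite mem_head.
have [z [Fjz Uz]] := meetU j Dj.
have [l1 h1] := connected_walk cU oF UF Ux Uz.
have [|l2 h2 sub2] := IH _ z y Uz Uy.
  by move=> i si; apply: sD; rewrite in_cons si orbT.
exists (l1 ++ j :: l2).
  by apply: walk_cat h1 _; split => //; exists z.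
move=> i; rewrite in_cons mem_cat in_cons => /orP[->|/sub2 ->];
  by rewrite ?orbT.
Qed.

End walks.

(** * Chains of connected sets and their refinement *)

Section chains.
Context (R : realType) (Y : metricType R).
Implicit Types (K L : nat) (s : nat -> set Y) (e : R).

(* A chain has the members [s 0], ..., [s K], but the last one is not needed to
   cover [Y]: it only serves the right end point of the unit interval. *)
Definition chain K s : Prop :=
  [/\ (0 < K)%N, forall i, (i <= K)%N -> connected (s i) /\ s i !=set0,
      forall i, (i < K)%N -> s i `&` s i.+1 !=set0 &
      forall y, exists2 i, (i < K)%N & s i y].

Definition mesh_lt e K s : Prop :=
  forall i, (i <= K)%N -> forall x y, s i x -> s i y -> mdist x y < e.

(** Each block of [L] members of [s'] belongs to one member of [s], which they have to meet but need
    not lie in. The closing index [K * L] belongs to [s K]. *)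
Definition refines K s L s' : Prop :=
  forall j, (j <= K * L)%N -> s' j `&` s (j %/ L)%N !=set0.

(** The point [y0] turns [Y] into a pointed type, the setting of [cover_compact]. *)
Lemma compact_open_cover (y0 : Y) (F : Y -> set Y) : compact [set: Y] ->
  (forall x, open (F x) /\ F x x) ->
  exists D : seq Y, forall y, exists2 x, x \in D & F x y.
Proof.
move=> cY oF.
pose PY : ptopologicalType :=
  HB.pack (Metric.sort Y) (Metric.class Y) (isPointed.Build Y y0).
have : cover_compact [set: PY] by rewrite -compact_cover.
move=> /(_ _ setT F (fun i _ => (oF i).1))[y _|D _ hD].
  by exists y => //; exact: (oF y).2.
exists (finmap.enum_fset D) => y.
by have [x Dx Fxy] := hD y I; exists x.
Qed.

Lemma small_connected_cover (y0 : Y) e :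
  compact [set: Y] -> locally_connected Y -> 0 < e ->
  exists (F : Y -> set Y) (D : seq Y),
    [/\ forall x, open (F x) /\ F x x, forall x, connected (F x),
        forall x y z, F x y -> F x z -> mdist y z < e &
        forall y, exists2 x, x \in D & F x y].
Proof.
move=> cY lcY e0.
have e20 : 0 < e / 2 by lra.
have /choice[F hF] x := lcY x (ball x (e / 2)) (nbhsx_ballx x _ e20).
have oF x : open (F x) by have [] := hF x.
have Fx x : F x x by have [] := hF x.
have [D hD] := compact_open_cover y0 cY (fun x => conj (oF x) (Fx x)).
exists F, D; split => // [x|x y z].
- by have [] := hF x.
- have [_ _ _ sub] := hF x; move=> /sub + /sub.
  rewrite ballEmdist /= => h1 h2.
  by have := metric_triangle y x z; rewrite (metric_sym y x); lra.
Qed.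

Lemma chain_refine K s e : compact [set: Y] -> locally_connected Y ->
  chain K s -> 0 < e -> exists L s',
    [/\ (0 < L)%N, chain (K * L)%N s', mesh_lt e (K * L)%N s' &
        refines K s L s'].
Proof.
move=> cY lcY [K0 hs meet_s cov_s] e0.
have [y0 _] : [set: Y] !=set0 by have [_ [y _]] := hs 0%N isT; exists y.
have [F [D [oF cF smallF covF]]] := small_connected_cover y0 cY lcY e0.
(* [a i] is a common point of [s i] and its predecessor; the walk replacing
   [s i] goes from [a i] to [b i]. *)
have /choice[a ha] i : exists a, (i <= K)%N -> s i a /\ ((0 < i)%N -> s i.-1 a).
  case: i => [|i].
    by have [_ [a sa]] := hs 0%N isT; exists a.
  have [iK|iK] := leqP i.+1 K; last by exists y0.
  by have [a [sa sa']] := meet_s i iK; exists a.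
(* The last member has no successor, so its walk returns to its starting point. *)
pose b i := a (if (i < K)%N then i.+1 else i).
have sb i : (i <= K)%N -> s i (b i).
  rewrite /b; case: ltnP => iK iK'; last by have [] := ha i iK'.
  by have [_ /(_ isT)] := ha i.+1 iK.
pose Di i : set Y := [set j | j \in D /\ F j `&` s i !=set0].
have covD i : s i `<=` cover (Di i) F.
  move=> y sy; have [j Dj Fj] := covF y; exists j => //; split => //.
  by exists y.
have /choice[l hl] i : exists l, (i <= K)%N ->
    [/\ walk F (Di i) (a i) (b i) l, forall j, Di i j -> j \in l &
        (0 < size l)%N].
  have [iK|iK] := leqP i K; last by exists [::].
  have sDi j : j \in [seq j <- D | `[< F j `&` s i !=set0 >]] -> Di i j.
    by rewrite mem_filter => /andP[/asboolP ? ?].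
  have meetD j : Di i j -> F j `&` s i !=set0 by case.
  have [l hl sub] := connected_tour (hs i iK).1 (fun j _ => (oF j).1) (@covD i)
    meetD sDi (ha i iK).1 (sb i iK).
  have lD j : Di i j -> j \in l.
    by move=> [Dj mj]; apply: sub; rewrite mem_filter Dj andbT; apply/asboolP.
  exists l; split => //; have [j Dij _] := covD i _ (sb i iK).
  by have := lD j Dij; case: (l).
have /choice[c hc] i : exists c, (i <= K)%N -> Di i c /\ F c (b i).
  have [iK|iK] := leqP i K; last by exists y0.
  by have [j Dj Fj] := covD i _ (sb i iK); exists j.
pose L := (\max_(i < K.+1) size (l i))%N.
have lL i : (i <= K)%N -> (size (l i) <= L)%N.
  by move=> iK; exact: (leq_bigmax (Ordinal (iK : (i < K.+1)%N))).
have L0 : (0 < L)%N.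
  by have [_ _ h] := hl 0%N isT; exact: leq_trans h (lL 0%N isT).
(* Padding gives all walks the same length [L]. *)
pose w i := l i ++ nseq (L - size (l i)) (c i).
have size_w i : (i <= K)%N -> size (w i) = L.
  by move=> iK; rewrite size_cat size_nseq subnKC // lL.
have walk_w i : (i <= K)%N -> walk F (Di i) (a i) (b i) (w i).
  move=> iK; have [h _ _] := hl i iK; have [h1 h2] := hc i iK.
  exact: walk_cat h (walk_nseq _ h1 h2).
pose s' j := F (nth y0 (w (j %/ L)%N) (j %% L)%N).
have divK j : (j <= K * L)%N -> (j %/ L <= K)%N.
  by move=> jK; rewrite -(mulnK K L0) leq_div2r.
exists L, s'; split => //.
- split; first by rewrite muln_gt0 K0.
  + by move=> j _; split; [exact: cF|eexists; exact: (oF _).2].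
  + move=> j jKL; have jK : (j %/ L < K)%N by rewrite ltn_divLR.
    have jL : (j %% L < L)%N by rewrite ltn_mod.
    have ww := walk_w _ (ltnW jK).
    rewrite /s' {3 4}(divn_eq j L) -addnS.
    have [h|h] := ltnP (j %% L)%N.+1 L.
      rewrite divnMDl // modnMDl (divn_small h) (modn_small h) addn0.
      by apply: walk_meet ww _; rewrite size_w // ltnW.
    (* At the border of two blocks, the last set of one walk and the first set of the next share the
       point [a (j %/ L).+1]. *)
    have -> : (j %% L)%N.+1 = L by apply/eqP; rewrite eqn_leq jL.
    have Lj : (j %% L)%N = L.-1.
      by apply/eqP; rewrite eqn_leq -ltnS prednK // jL -ltnS prednK.
    rewrite divnMDl // modnMDl divnn modnn L0 addn1 Lj.
    exists (a (j %/ L)%N.+1); split.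
      have := walk_last y0 ww; rewrite size_w ?(ltnW jK)// => /(_ L0).
      by rewrite /b jK.
    by apply: walk_head (walk_w _ jK) _; rewrite size_w.
  + move=> y; have [i iK sy] := cov_s y; have [j Dj Fj] := covF y.
    (* A cover member through [y] meets [s i], hence is visited by the [i]-th walk; its position
       there gives the index in [s']. *)
    have jw : j \in w i.
      have [_ h _] := hl i (ltnW iK); rewrite mem_cat h //; split => //.
      by exists y.
    have kL : (index j (w i) < L)%N by rewrite -(size_w i (ltnW iK)) index_mem.
    exists (i * L + index j (w i))%N.
      rewrite (@leq_trans (i.+1 * L)%N) ?leq_mul2r ?iK ?orbT //.
      by rewrite mulSn addnC ltn_add2r.
    by rewrite /s' divnMDl // modnMDl (divn_small kL) (modn_small kL) addn0
       nth_index.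
- by move=> j _ x y; exact: smallF.
- move=> j jKL; have jK := divK j jKL.
  have := @walk_mem _ _ F _ _ _ _ (nth y0 (w (j %/ L)%N) (j %% L)%N)
    (walk_w _ jK).
  by rewrite mem_nth ?size_w ?ltn_mod // => /(_ isT)[].
Qed.

Lemma chain_sequence : compact [set: Y] -> connected [set: Y] ->
  locally_connected Y -> [set: Y] !=set0 ->
  exists (K : nat -> nat) (s : nat -> nat -> set Y), forall n,
    [/\ chain (K n) (s n), mesh_lt (2^-1 ^+ n) (K n) (s n) &
        exists L, [/\ (0 < L)%N, K n.+1 = (K n * L)%N &
          refines (K n) (s n) L (s n.+1)]].
Proof.
move=> cY coY lcY Y0.
have step (p : nat * (nat * (nat -> set Y))) :
    exists q : nat * (nat * (nat -> set Y)), chain p.2.1 p.2.2 ->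
    [/\ (0 < q.1)%N, q.2.1 = (p.2.1 * q.1)%N, chain q.2.1 q.2.2,
        mesh_lt (2^-1 ^+ p.1) q.2.1 q.2.2 & refines p.2.1 p.2.2 q.1 q.2.2].
  have [h|h] := pselect (chain p.2.1 p.2.2); last by exists p.
  have [|L [s' [L0 c m r]]] := chain_refine (e := 2^-1 ^+ p.1) cY lcY h.
    by rewrite exprn_gt0 // invr_gt0.
  by exists (L, ((p.2.1 * L)%N, s')).
have [nxt hnxt] := choice step.
(* The start is the trivial chain with both members equal to [Y]. It has no mesh bound, hence the
   shift by one in the witnesses below. *)
pose c := fix c n := if n is m.+1 then (nxt (m, c m)).2
                     else (1%N, fun=> [set: Y]).
have cc n : chain (c n).1 (c n).2.
  elim: n => [|n IH]; last by have [] := hnxt (n, c n) IH.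
  split => //= [i _|y]; last by exists 0%N.
  by rewrite setIT.
exists (fun n => (c n.+1).1), (fun n => (c n.+1).2) => n; split.
- exact: cc.
- by have [] := hnxt (n, c n) (cc n).
- exists (nxt (n.+1, c n.+1)).1.
  by have [] := hnxt (n.+1, c n.+1) (cc n.+1).
Qed.

End chains.

(** * Step functions along refining chains and their limit *)

Section hahn_mazurkiewicz.
Context (R : realType).
Local Notation I := (unit_interval R).

(** This makes the index of a point in a finer subdivision compatible with its index in the coarser
    one. *)
Lemma truncn_divn (x : R) (L : nat) : 0 <= x -> (0 < L)%N ->
  (Num.truncn (x * L%:R) %/ L)%N = Num.truncn x.
Proof.
move=> x0 L0; have xL0 : 0 <= x * L%:R by rewrite mulr_ge0.
have LR : 0 < L%:R :> R by rewrite ltr0n.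
have /andP[h1 h2] := truncn_itv x0.
apply/eqP; rewrite eqn_leq -ltnS ltn_divLR // leq_divRL // truncn_lt_nat //.
by rewrite truncn_ge_nat // !natrM ltr_pM2r // h2 ler_pM2r.
Qed.

Lemma truncn_near (x y : R) : 0 <= x -> x <= y -> y < x + 1 ->
  Num.truncn y = Num.truncn x \/ Num.truncn y = (Num.truncn x).+1.
Proof.
move=> x0 xy yx; have y0 : 0 <= y by lra.
have /andP[h1 h2] := truncn_itv x0.
have [h|h] := leP (Num.truncn x).+1%:R y; [right|left]; apply: truncn_def.
  by rewrite h /=; move: h2; rewrite -!natr1; lra.
by rewrite h andbT; lra.
Qed.

Lemma hahn_mazurkiewicz (Y : metricType R) : peano_space R Y ->
  exists f : cmaps Y, peano_maps Y f.
Proof.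
move=> [Y0 cY coY lcY _].
have [K [s hs]] := chain_sequence cY coY lcY Y0.
have K0 n : (0 < K n)%N by have [[]] := hs n.
pose e n : R := 2^-1 ^+ n.
have e0 n : 0 < e n by rewrite exprn_gt0 // invr_gt0.
have eS n : e n = 2 * e n.+1.
  by rewrite /e exprS mulrA mulfV ?mul1r // pnatr_eq0.
have [y0 _] := Y0.
have /choice[p hp] (q : nat * nat) :
    exists y, (q.2 <= K q.1)%N -> s q.1 q.2 y.
  have [h|h] := leqP q.2 (K q.1); last by exists y0.
  by have [[_ /(_ _ h)[_ [y sy]] _ _] _ _] := hs q.1; exists y.
(* The piece of the [n]-th subdivision containing [t]; only [t = 1] gets the extra index [K n]. *)
pose idx n (t : I) := Num.truncn (val t * (K n)%:R).
have t0 n (t : I) : 0 <= val t * (K n)%:R.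
  by rewrite mulr_ge0 // unit_interval_ge0.
have idxK n t : (idx n t <= K n)%N.
  rewrite /idx truncn_le_nat -natr1.
  have := ler_wpM2r (ler0n R (K n)) (unit_interval_le1 t); lra.
pose u n t := p (n, idx n t).
have su n t : s n (idx n t) (u n t) by exact: (hp (n, idx n t) (idxK n t)).
have mesh n : mesh_lt (e n) (K n) (s n) by have [_ + _] := hs n.
have uS n t : mdist (u n t) (u n.+1 t) < e n + e n.+1.
  have [_ _ [L [L0 KS ref]]] := hs n.
  have idxS : (idx n.+1 t %/ L)%N = idx n t.
    by rewrite /idx KS natrM mulrA truncn_divn.
  have [|z []] := ref (idx n.+1 t); first by rewrite -KS.
  rewrite idxS => z1 z2.
  have := mesh n _ (idxK n t) _ _ (su n t) z2.
  have := mesh n.+1 _ (idxK n.+1 t) _ _ z1 (su n.+1 t).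
  by have := metric_triangle (u n t) z (u n.+1 t); lra.
(* Telescoping: [e n + e n.+1] equals [3 * e n - 3 * e n.+1]. *)
have u_cauchy n m t :
    mdist (u n t) (u (n + m)%N t) <= 3 * e n - 3 * e (n + m)%N.
  elim: m => [|m IH]; first by rewrite addn0 mdistxx; lra.
  rewrite addnS; have := uS (n + m)%N t; have := eS (n + m)%N.
  by have := metric_triangle (u n t) (u (n + m)%N t) (u (n + m).+1 t); lra.
(* The factor 10 covers every later estimate; the largest, for continuity, is [3 + 2 + 3] times
   [e n]. *)
have small_e d : 0 < d -> exists n, 10 * e n < d.
  move=> d0; have half : `|2^-1| < 1 :> R by rewrite ger0_norm; lra.
  have /cvgrPdist_lt/(_ d d0)[n _ /(_ n (leqnn n))] := cvg_geometric 10 half.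
  by rewrite /= sub0r normrN => h; exists n; exact: le_lt_trans (ler_norm _) h.
have /choice[f hf] t : exists l : Y, (fun n => u n t : Y) @ \oo --> l.
  apply: compact_complete cY _ _ => d /small_e[N hN]; exists N => i j Ni Nj.
  have := u_cauchy N (i - N)%N t; have := u_cauchy N (j - N)%N t.
  rewrite !subnKC // => h1 h2.
  have := metric_triangle (u i t) (u N t) (u j t).
  rewrite (metric_sym _ (u N t)); have := e0 N; have := e0 i; have := e0 j; lra.
have uf n t : mdist (u n t) (f t) <= 3 * e n.
  rewrite leNgt; apply/negP => h.
  have [|N hN] := (metric_cvgP _ _).1 (hf t) (mdist (u n t) (f t) - 3 * e n).
    by lra.
  have := hN (n + N)%N (leq_addl _ _); have := u_cauchy n N t.
  have := e0 (n + N)%N.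
  have := metric_triangle (u n t) (u (n + N)%N t) (f t).
  by rewrite (metric_sym (u (n + N)%N t)); lra.
(* Such points lie in the same or in consecutive pieces, and consecutive chain members meet. *)
have u_near n (x y : I) : val x <= val y -> val y < val x + (K n)%:R^-1 ->
    mdist (u n x) (u n y) < 2 * e n.
  move=> xy yx; have KR : 0 < (K n)%:R :> R by rewrite ltr0n.
  have : idx n y = idx n x \/ idx n y = (idx n x).+1.
    apply: truncn_near => //; first by rewrite ler_pM2r.
    by rewrite -ltr_pdivlMr // mulrDl mul1r mulfK // gt_eqF.
  move=> [E|E].
    have sy := su n y; rewrite E in sy.
    by have := mesh n _ (idxK n x) _ _ (su n x) sy; have := e0 n; lra.
  have [[_ _ meet _] _ _] := hs n.
  have [|z [z1 z2]] := meet (idx n x); first by rewrite -E.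
  rewrite -E in z2.
  have := mesh n _ (idxK n x) _ _ (su n x) z1.
  have := mesh n _ (idxK n y) _ _ z2 (su n y).
  by have := metric_triangle (u n x) z (u n y); lra.
have cf : continuous f.
  apply/metric_continuousP => x d /small_e[n hn].
  exists (K n)%:R^-1; first by rewrite invr_gt0 ltr0n.
  move=> y; rewrite unit_interval_mdistE ltr_norml => /andP[h1 h2].
  have h : mdist (u n x) (u n y) < 2 * e n.
    have [xy|/ltW yx] := leP (val x) (val y); first by apply: u_near; lra.
    by rewrite metric_sym; apply: u_near; lra.
  have := metric_triangle (f x) (u n x) (f y).
  have := metric_triangle (u n x) (u n y) (f y).
  have := uf n x; have := uf n y; rewrite (metric_sym (f x) (u n x)).
  by have := e0 n; lra.
have [g gf] := cmap_of_continuous cf; exists g => y _.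
have : [set: Y] y by [].
rewrite -(compact_dense (A := range g)).
- by move=> [t _ <-]; exists t.
- apply: continuous_compact (@unit_interval_compact R).
  exact/continuous_subspaceT/cmaps_continuous.
- move=> z d /small_e[n hn].
  have [[_ _ _ cov] _ _] := hs n; have [i iK sz] := cov z.
  have KR : 0 < (K n)%:R :> R by rewrite ltr0n.
  (* The left end of the piece [i]: there [u n t] lies in the same chain member as [z]. *)
  pose t := clamp (i%:R / (K n)%:R : R).
  have it : idx n t = i.
    rewrite /idx val_clamp ?divr_ge0 // ?ler_pdivrMr ?mul1r ?ler_nat
      ?(ltnW iK) //.
    by rewrite divfK ?gt_eqF // natrK.
  exists (g t); first by exists t.
  have st := su n t; rewrite it in st.
  have := mesh n _ (ltnW iK) _ _ sz st; have := uf n t.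
  by have := metric_triangle z (u n t) (f t); have := e0 n; rewrite gf; lra.
Qed.

End hahn_mazurkiewicz.

(** * Spaces of Peano maps *)

Lemma continuousT_comp (T U V : topologicalType) (f : T -> U) (g : U -> V) :
  continuous f -> continuous g -> continuous (g \o f).
Proof. by move=> cf cg x; apply: continuous_comp; [exact: cf|exact: cg]. Qed.

Lemma cmap_clamp_continuous (R : realType) (Y : metricType R) (f : cmaps Y) :
  continuous (fun x : R^o => f (clamp x)).
Proof.
exact: continuousT_comp (@clamp_continuous R) (@cmaps_continuous _ _ f).
Qed.

(** * Closedness, complete metrizability and failure of compactness *)

Section peano_maps_facts.
Context (R : realType) (Y : metricType R).
Local Notation I := (unit_interval R).

Lemma peano_maps_closed : closed (peano_maps Y).
Proof.
move=> f /metric_closureP clf y _.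
have : [set: Y] y by [].
rewrite -(compact_dense (A := range f)).
- by move=> [t _ <-]; exists t.
- apply: continuous_compact (@unit_interval_compact R).
  exact/continuous_subspaceT/cmaps_continuous.
- move=> z e e0; have [g gP fg] := clf e e0; have [t _ gt] := gP z Logic.I.
  exists (f t); first by exists t.
  by rewrite -gt metric_sym; exact: le_lt_trans (cmaps_mdist_ub f g t) fg.
Qed.

Lemma closed_completely_metrizable (T : metricType R) (A : set T) :
  complete_metric (@mdist R T) -> closed A ->
  completely_metrizable R (set_type A).
Proof.
move=> cT cA; exists (fun x y => mdist (val x) (val y)).
have nbhsE (x : A) : nbhs x =
    nbhs_ball_ (fun (c : A) e => [set y : A | mdist (val c) (val y) < e]) x.
  rewrite -nbhs_ballE /nbhs_ball; congr (nbhs_ball_ _ x).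
  apply/funext => c; apply/funext => d; apply/seteqP.
  have bE (y : A) : ball c d y = ball (val c : T) d (val y) by [].
  by split=> y; rewrite bE ballEmdist.
split.
  split => //.
  - by move=> x; rewrite mdistxx.
  - by move=> x y /mdist_positivity/val_inj.
  - by move=> x y; rewrite metric_sym.
  - by move=> y x z; exact: metric_triangle.
move=> u cu; have [l ul] := cT (val \o u) cu.
move/metric_cvgP in ul.
have Al : A l.
  apply/cA/metric_closureP => e e0; have [N hN] := ul e e0.
  by exists (val (u N)); [exact: set_valP|exact: hN].
exists (exist _ l (mem_set Al)) => B.
rewrite nbhsE => -[e /= e0 he]; have [N hN] := ul e e0.
by exists N => // n Nn; apply: he; exact: hN.
Qed.

Lemma peano_maps_not_compact (y z : Y) : y <> z -> peano_maps Y !=set0 ->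
  ~ compact (peano_maps Y).
Proof.
move=> yz [f fP] cP.
pose h n (t : I) := f (clamp (n.+1%:R * val t)).
have ch n : continuous (h n).
  have cm : continuous (fun x : R^o => n.+1%:R * x : R^o).
    by move=> x; apply: cvgMl_tmp; exact: cvg_id.
  exact: continuousT_comp (continuousT_comp (@val_continuous R) cm)
    (@cmap_clamp_continuous _ _ f).
have [u uh] := choice (fun n => cmap_of_continuous (ch n)).
have uP n : peano_maps Y (u n).
  move=> w /fP[t _ <-]; exists (clamp (val t / n.+1%:R)) => //.
  rewrite uh /h val_clamp ?divr_ge0 ?unit_interval_ge0//.
    by rewrite mulrC divfK ?pnatr_eq0// valK_clamp.
  rewrite ler_pdivrMr// mul1r (le_trans (unit_interval_le1 t))//.
  by rewrite ler1n.
have [|g [gP clg]] := cP (u @ \oo) _; first by exists 0%N => // n _; exact: uP.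
have near_g e : 0 < e -> forall N, exists2 n, (N <= n)%N & mdist g (u n) < e.
  move=> e0 N.
  have hu : (u @ \oo) (u @` [set m | (N <= m)%N]).
    by exists N => // m /= Nm; exists m.
  have [_ [[m /= Nm <-]]] := clg _ _ hu (nbhsx_ballx g _ e0).
  by rewrite ballEmdist; exists m.
have g1 t : 0 < val t -> g t = f (ui1 R).
  move=> t0; apply: mdist_positivity; apply/eqP; rewrite eq_le mdist_ge0 andbT.
  apply/ler_addgt0Pr => e e0; rewrite add0r.
  (* From this index on [n.+1 * val t] is at least 1, so [u n t] equals [f] at 1. *)
  have [n Nn gu] := near_g e e0 (Num.truncn (val t)^-1).
  have -> : f (ui1 R) = u n t.
    rewrite uh /h; congr (f _); apply/val_inj => /=.
    rewrite min_l ?max_r// -ler_pdivrMr// div1r.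
    by rewrite (le_trans (ltW (truncnS_gt _)))// ler_nat.
  exact: le_trans (cmaps_mdist_ub _ _ _) (ltW gu).
suff gc t : g t = f (ui1 R).
  apply: yz; have [s _ <-] := gP y Logic.I.
  by have [s' _ <-] := gP z Logic.I; rewrite !gc.
have [|t0] := ltP 0 (val t); first exact: g1.
apply: mdist_positivity; apply/eqP; rewrite eq_le mdist_ge0 andbT.
apply/ler_addgt0Pr => e e0; rewrite add0r.
have [d d0 hd] := (metric_continuousP _).1 (@cmaps_continuous _ _ g) t e e0.
(* At [t = 0] the value follows by continuity from a nearby positive parameter. *)
pose s := clamp (Num.min (d / 2) 1) : I.
have d1 : 0 < Num.min (d / 2) 1 by rewrite lt_min; apply/andP; split; lra.
have vs : val s = Num.min (d / 2) 1.
  by rewrite val_clamp ?(ltW d1) // ge_min lexx orbT.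
rewrite -(g1 s) ?vs//; apply/ltW/hd; rewrite unit_interval_mdistE vs.
have -> : val t = 0 by apply/le_anti; rewrite t0 unit_interval_ge0.
by rewrite sub0r normrN gtr0_norm// gt_min; apply/orP; left; lra.
Qed.

End peano_maps_facts.

(** * Gluing paths on consecutive intervals *)

Section gluing.
Context (R : realType) (Y : metricType R).

Lemma continuous_glue (g1 g2 : R^o -> Y) (a : R) : continuous g1 ->
  continuous g2 -> g1 a = g2 a ->
  continuous (fun t : R^o => if t <= a then g1 t else g2 t).
Proof.
move=> /(metric_continuousP (T := R^o)) c1.
move=> /(metric_continuousP (T := R^o)) c2 ga.
apply/(metric_continuousP (T := R^o)) => x e e0.
have [d1 d10 h1] := c1 x e e0; have [d2 d20 h2] := c2 x e e0.
have [->|xa] := eqVneq x a.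
  have [d1' d10' h1'] := c1 a e e0; have [d2' d20' h2'] := c2 a e e0.
  exists (Num.min d1' d2'); first by rewrite lt_min d10'.
  move=> y; rewrite lt_min lexx => /andP[y1 y2].
  by case: ifP => _; [exact: h1'|rewrite ga; exact: h2'].
(* The last term keeps [y] on the same side of [a] as [x]. *)
exists (Num.min (Num.min d1 d2) `|a - x|).
  by rewrite !lt_min d10 d20 normr_gt0 subr_eq0 eq_sym.
move=> y; rewrite !lt_min => /andP[/andP[y1 y2]].
rewrite {1}/mdist /= => y3.
have [xa'|xa'] := leP x a; have [ya|ya] := leP y a.
- exact: h1.
- by move: y3; rewrite !ger0_norm; lra.
- by move: y3; rewrite !ler0_norm; lra.
- exact: h2.
Qed.

Lemma glue_paths (p : nat -> R^o -> Y) (N : nat) :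
  (forall i, continuous (p i)) -> (forall i, p i 1 = p i.+1 0) ->
  exists2 g : R^o -> Y, continuous g & forall i, (i <= N)%N ->
    forall t, i%:R <= t -> t <= i.+1%:R -> g t = p i (t - i%:R).
Proof.
move=> cp pS; elim: N => [|N [g cg gp]].
  exists (p 0%N) => // i; rewrite leqn0 => /eqP -> t _ _.
  by rewrite subr0.
have cpS : continuous (fun t : R^o => p N.+1 (t - N.+1%:R) : Y).
  have cs : continuous (fun t : R^o => t - N.+1%:R : R^o).
    by move=> t; apply: cvgB; [exact: cvg_id|exact: cvg_cst].
  exact: continuousT_comp cs (cp _).
have gN : g N.+1%:R = p N.+1 0.
  by rewrite (gp N)// ?ler_nat// -natr1 addrAC subrr add0r pS.
exists (fun t => if t <= N.+1%:R then g t else p N.+1 (t - N.+1%:R)).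
  by apply: continuous_glue => //; rewrite subrr.
move=> i; rewrite leq_eqVlt => /orP[/eqP ->|iN] t t1 t2.
  case: leP => // t3; have -> : t = N.+1%:R by apply/le_anti; rewrite t1 t3.
  by rewrite subrr.
rewrite (le_trans t2) ?ler_nat//.
exact: gp.
Qed.

End gluing.

(** * Empty interior: approximation by maps that omit a point *)

Section avoiding_a_point.
Context (R : realType) (Y : metricType R).
Local Notation I := (unit_interval R).

(** Otherwise the singleton of [y0] would be open and closed, hence the whole space. *)
Lemma punctured_nbhs_nonempty (y0 y z : Y) (V : set Y) : connected [set: Y] ->
  y <> z -> nbhs y0 V -> V `\ y0 !=set0.
Proof.
move=> cY yz V0; apply: contrapT => h.
have Vy0 w : V w -> w = y0.
  by move=> Vw; apply: contrapT => wy0; apply: h; exists w.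
have y0T : [set y0] = [set: Y].
  apply: cY; first by exists y0.
    exists [set y0]; last by rewrite setTI.
    rewrite openE => _ ->; rewrite /interior; apply: filterS V0 => w.
    exact: Vy0.
  exists [set y0]; last by rewrite setTI.
  apply: compact_closed; [exact: metric_hausdorff|exact: compact_set1].
have ally w : w = y0 by have : [set: Y] w by []; rewrite -y0T.
by apply: yz; rewrite (ally y) (ally z).
Qed.

Lemma cmap_avoiding_point (y0 v0 : Y) (V : set Y) (f : cmaps Y) (e : R) :
  nbhs y0 V -> V `<=` ball y0 (e / 2) -> arcwise_connected R (V `\ y0) ->
  (V `\ y0) v0 -> exists g : cmaps Y,
    forall t, g t <> y0 /\ mdist (f t) (g t) < e.
Proof.
move=> V0 Ve aV Vv0.
have : nbhs y0 V := V0.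
move=> /metricType_numDomainType.nbhs_mdistP[d /= d0 dV].
have [m m0 hm] := compact_uniformly_continuous (@unit_interval_compact R)
  (@cmaps_continuous _ _ f) d0.
(* Pieces of length [1 / N] are shorter than the modulus [m], so a piece on which [f] takes the
   value [y0] is mapped into [V]. *)
pose N := (Num.truncn m^-1).+1.
have N0 : 0 < N%:R :> R by rewrite ltr0n.
have Nm : N%:R^-1 < m.
  by rewrite -[m]invrK ltf_pV2 ?posrE ?invr_gt0//; exact: truncnS_gt.
pose F i (s : R) := f (clamp ((i%:R + s) / N%:R)).
(* The new values at the division points; they depend on [i] alone, so that neighbouring pieces fit
   together. *)
pose q i := if `[< F i 0 = y0 >] then v0 else F i 0.
have FS i : F i 1 = F i.+1 0 by rewrite /F addr0 natr1.
have cF i : continuous (F i : R^o -> Y).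
  have cm : continuous (fun s : R^o => (i%:R + s) / N%:R : R^o).
    move=> s; apply: cvgMr_tmp.
    by apply: cvgD; [exact: cvg_cst|exact: cvg_id].
  exact: continuousT_comp cm (@cmap_clamp_continuous _ _ f).
have /choice[p hp] i : exists p : R^o -> Y,
    [/\ continuous p, p 0 = q i, p 1 = q i.+1 &
        forall s, 0 <= s -> s <= 1 -> p s <> y0 /\ mdist (F i s) (p s) < e].
  have [[s [s0 s1 Fs]]|nF] :=
    pselect (exists s, [/\ 0 <= s, s <= 1 & F i s = y0]); last first.
    have nF' s : 0 <= s -> s <= 1 -> F i s <> y0.
      by move=> s0 s1 Fs; apply: nF; exists s.
    have e0 : 0 < e.
      have := Ve _ Vv0.1; rewrite ballEmdist /=.
      by have := mdist_ge0 y0 v0; lra.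
    exists (F i); split => //.
    + by rewrite /q asboolF//; apply: nF'.
    + by rewrite /q asboolF -FS//; apply: nF'.
    + by move=> s s0 s1; rewrite mdistxx; split => //; exact: nF'.
  have FV r : 0 <= r -> r <= 1 -> V (F i r).
    move=> r0 r1; apply: dV; rewrite /= -Fs; apply: hm.
    apply: le_lt_trans (clamp_lipschitz _ _) _; apply: le_lt_trans Nm.
    rewrite -mulrBl normrM (gtr0_norm (_ : 0 < N%:R^-1)) ?invr_gt0//.
    rewrite ler_piMl ?invr_ge0 ?(ltW N0)// ler_norml; apply/andP; split; lra.
  have qV j r : 0 <= r -> r <= 1 -> F i r = F j 0 -> (V `\ y0) (q j).
    move=> r0 r1 Fr; rewrite /q; case: asboolP => // h; split => //.
    by rewrite -Fr; exact: FV.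
  have q0 : (V `\ y0) (q i) by apply: (qV i 0).
  have q1 : (V `\ y0) (q i.+1) by apply: (qV i.+1 1).
  have close y r : 0 <= r -> r <= 1 -> (V `\ y0) y ->
      y <> y0 /\ mdist (F i r) y < e.
    move=> r0 r1 [Vy yy0]; split => //.
    have := Ve _ Vy; have := Ve _ (FV r r0 r1); rewrite !ballEmdist /=.
    by have := metric_triangle (F i r) y0 y; rewrite (metric_sym _ y0); lra.
  (* Arcs join distinct points only; equal ends are joined by a constant path. *)
  have [qq|qq] := pselect (q i = q i.+1).
    exists (fun=> q i); split => //; first by move=> ?; exact: cvg_cst.
    by move=> r r0 r1; exact: close.
  have [g [[cg _ _] g0 g1 gV]] := aV _ _ q0 q1 qq.
  exists (g \o @clamp R); split.
  - exact: continuousT_comp (@clamp_continuous R) cg.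
  - by rewrite /= -g0; congr g; apply/val_inj; rewrite val_clamp.
  - by rewrite /= -g1; congr g; apply/val_inj; rewrite val_clamp.
  - by move=> r r0 r1; apply: close => //; apply: gV; exists (clamp r).
have cp i : continuous (p i) by have [] := hp i.
have [|h ch hpE] := glue_paths N cp.
  by move=> i; have [_ _ -> _] := hp i; have [_ -> _ _] := hp i.+1.
have cg : continuous (fun t : I => h (val t * N%:R) : Y).
  have cm : continuous (fun x : R^o => x * N%:R : R^o).
    by move=> x; apply: cvgMr_tmp; exact: cvg_id.
  exact: continuousT_comp (continuousT_comp (@val_continuous R) cm) ch.
have [g gh] := cmap_of_continuous cg; exists g => t.
have t0 : 0 <= val t * N%:R by rewrite mulr_ge0// unit_interval_ge0.
have /andP[i1 /ltW i2] := truncn_itv t0.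
set i := Num.truncn (val t * N%:R) in i1 i2.
(* The value [i = N] occurs at [t = 1]; the clamp makes [F N] constant on its piece. *)
have iN : (i <= N)%N.
  rewrite /i truncn_le_nat -natr1.
  have := ler_wpM2r (ler0n R N) (unit_interval_le1 t); lra.
have -> : f t = F i (val t * N%:R - i%:R).
  by rewrite /F addrC subrK mulfK ?gt_eqF// valK_clamp.
rewrite gh (hpE i iN)//; have [_ _ _] := hp i; apply; first by lra.
by move: i2; rewrite -natr1; lra.
Qed.

Lemma peano_maps_interior0 : connected [set: Y] ->
  (exists y z : Y, y <> z) ->
  (exists y0 : Y, forall U : set Y, nbhs y0 U -> exists V : set Y,
     [/\ nbhs y0 V, V `<=` U & arcwise_connected R (V `\ y0)]) ->
  interior (peano_maps Y) = set0.
Proof.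
move=> cY [y [z yz]] [y0 hy0]; apply/seteqP; split => // f.
move=> /metricType_numDomainType.nbhs_mdistP[e /= e0 fe].
(* One halving is required by [cmap_avoiding_point]; the other keeps the supremum strictly below
   [e]. *)
have [|V [V0 Ve aV]] := hy0 (ball y0 (e / 2 / 2)).
  by apply: nbhsx_ballx; lra.
have [v0 Vv0] := punctured_nbhs_nonempty cY yz V0.
have [g hg] := cmap_avoiding_point f V0 Ve aV Vv0.
have [|t _] := fe g _ y0 Logic.I; last by case: (hg t).
have : mdist f g <= e / 2.
  by apply: cmaps_mdist_le => t; apply/ltW; case: (hg t).
by move=> /=; lra.
Qed.

End avoiding_a_point.

(** * Strong porosity for the square *)

Section porosity.
Context (R : realType).
Local Notation I := (unit_interval R).

Lemma strongly_porous_square : strongly_porous (peano_maps (I * I)%type).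
Proof.
move=> al al0 al1 f e e0.
(* The bound [e / 2] keeps [g] in the ball around [f], and [1 / 2] ensures that [1 - r] is at least
   [r]. *)
pose r := Num.min (e / 2) (1 / 2).
have r0 : 0 < r by rewrite lt_min; apply/andP; split; lra.
have [re r2] : r <= e / 2 /\ r <= 1 / 2 by rewrite !ge_min !lexx orbT.
pose a t := val (f t).1.
have a0 t : 0 <= a t by exact: unit_interval_ge0.
have a1 t : a t <= 1 by exact: unit_interval_le1.
have [phi [phi_lip phi_r phi1 phi_a [t0 phit0]]] : exists phi : R -> R,
    [/\ forall x y, `|phi x - phi y| <= `|x - y|, forall t, r <= phi (a t),
        forall t, phi (a t) <= 1, forall t, `|a t - phi (a t)| <= r &
        exists t, phi (a t) != a t].
  have [[t at1]|at1] := pselect (exists t, a t != 1).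
    (* The affine map of [[0, 1]] onto [[r, 1]] moves [x] by [r * (1 - x)], so it fixes only 1. *)
    exists (fun x => r + (1 - r) * x); split.
    - move=> x y.
      have -> : r + (1 - r) * x - (r + (1 - r) * y) = (1 - r) * (x - y).
        by ring.
      by rewrite normrM ler_piMl// ger0_norm; lra.
    - by move=> s; have := a0 s; nra.
    - by move=> s; have := a1 s; nra.
    - move=> s; have := a0 s; have := a1 s => s1 s0.
      by rewrite ler_norml; apply/andP; split; nra.
    - exists t; apply: contra at1 => /eqP h; apply/eqP.
      have : r * (1 - a t) = 0 by lra.
      by move=> /eqP; rewrite mulf_eq0 => /orP[]/eqP; lra.
  have aE t : a t = 1.
    by apply/eqP; apply: contrapT => /negP h; apply: at1; exists t.
  exists (fun=> 1 - r); split.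
  - by move=> x y; rewrite subrr normr0.
  - by move=> t; lra.
  - by move=> t; lra.
  - by move=> t; rewrite aE opprB addrC subrK ger0_norm; lra.
  - by exists (ui0 R); rewrite aE lt_eqF//; lra.
have cg : continuous (fun t => (clamp (phi (a t)), (f t).2) : I * I).
  apply/metric_continuousP => t d d0.
  have [m m0 hm] := (metric_continuousP _).1 (@cmaps_continuous _ _ f) t d d0.
  exists m => // s ts; have := hm s ts; rewrite !prod_mdistE !gt_max /=.
  move=> /andP[h1 ->]; rewrite andbT; apply: le_lt_trans h1.
  by apply: le_trans (clamp_lipschitz _ _) _; exact: phi_lip.
have [g gE] := cmap_of_continuous cg.
have vg t : val (g t).1 = phi (a t).
  by rewrite gE val_clamp//; exact: le_trans (ltW r0) (phi_r t).
have fg : mdist f g <= r.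
  apply: cmaps_mdist_le => t; rewrite prod_mdistE ge_max.
  by rewrite unit_interval_mdistE vg phi_a gE /= mdistxx ltW.
exists g; split.
- by rewrite ballEmdist /=; lra.
- by move=> gf; move: phit0; rewrite -vg gf eqxx.
- apply/seteqP; split => // h [].
  rewrite ballEmdist /= => gh hP.
  (* Where [h] hits the corner, [g] is at distance at least [r] from it, whereas [al * mdist f g] is
     at most [r]. *)
  have [t _ ht] := hP (ui0 R, ui0 R) Logic.I.
  have := cmaps_mdist_ub g h t; rewrite ht prod_mdistE ge_max => /andP[+ _].
  rewrite unit_interval_mdistE /= subr0 vg => h1.
  have := phi_r t; have := ler_norm (phi (a t)).
  by have := mdist_ge0 f g; nra.
Qed.

End porosity.

Theorem theorem3p1 (R : realType) :
  (forall Y : metricType R, peano_space R Y ->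
    [/\ closed (peano_maps Y) /\
          completely_metrizable R (set_type (peano_maps Y)),
        (exists y z : Y, y <> z) -> ~ compact (peano_maps Y)
      & (exists y z : Y, y <> z) ->
        (exists y0 : Y, forall U : set Y, nbhs y0 U ->
           exists V : set Y, [/\ nbhs y0 V, V `<=` U &
             arcwise_connected R (V `\ y0)]) ->
        interior (peano_maps Y) = set0 /\ nowhere_dense (peano_maps Y)])
  /\ strongly_porous
       (peano_maps (unit_interval R * unit_interval R)%type).
Proof.
split; last exact: strongly_porous_square.
move=> Y pY; have [_ cY coY _ _] := pY; have clP := @peano_maps_closed R Y.
split.
- split=> //; apply: closed_completely_metrizable clP.
  exact/cmaps_complete/compact_complete.
- move=> [y [z yz]]; apply: peano_maps_not_compact yz _.
  exact: hahn_mazurkiewicz.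
- move=> Y2 hy0; have i0 := peano_maps_interior0 coY Y2 hy0; split => //.
  by rewrite /nowhere_dense -(closure_id _).1.
Qed.
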